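(* Let $R$ be a commutative ring with $1$ such that $\frac{1}{2}\in R$, and let $L$ be a Lie superalgebra over $R$. Suppose that $L$ is perfect (i.e. $[L,L]=L$) and has zero center. Then: (1) $\mathrm{TDer}(L)=\mathrm{Der}(L)$; (2) $\mathrm{TDer}(\mathrm{Der}(L))=\mathrm{ad}(\mathrm{Der}(L))$, i.e. the triple derivations of the Lie superalgebra $\mathrm{Der}(L)$ are exactly its inner derivations.
   Context: A Lie superalgebra over a commutative ring $R$ with $1$ is a $\mathbf{Z}_2$-graded $R$-algebra $L=L_{\bar 0}\oplus L_{\bar 1}$ whose multiplication $[\,,\,]$ satisfies, for all homogeneous $x,y,z$: $[x,y]=-(-1)^{|x||y|}[y,x]$ and $[x,[y,z]]=[[x,y],z]+(-1)^{|x||y|}[y,[x,z]]$. Here $|x|$ is the $\mathbf{Z}_2$-degree of $x$; whenever $|x|$ or $|D|$ occurs in an expression, $x$ or $D$ is taken to be homogeneous. The center is $\mathrm{Z}(L)=\{x\in L: [x,L]=0\}$. An $R$-module endomorphism $D$ of a Lie superalgebra $L$ (homogeneous of degree $|D|$) is a derivation if $D([x,y])=[D(x),y]+(-1)^{|D||x|}[x,D(y)]$ for all $x,y$, and a triple derivation if $D([[x,y],z])=[[D(x),y],z]+(-1)^{|D||x|}[[x,D(y)],z]+(-1)^{|D|(|x|+|y|)}[[x,y],D(z)]$ for all $x,y,z$. $\mathrm{Der}(L)$ and $\mathrm{TDer}(L)$ denote the sets of all derivations and all triple derivations, where general elements are sums of homogeneous ones. $\mathrm{Der}(L)$ is a Lie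 superalgebra over $R$ under the bracket $[D_1,D_2]=D_1D_2-(-1)^{|D_1||D_2|}D_2D_1$, so $\mathrm{TDer}(\mathrm{Der}(L))$ makes sense. For a Lie superalgebra $G$, $\mathrm{ad}(G)=\{\mathrm{ad}\,x: x\in G\}$ with $\mathrm{ad}\,x(y)=[x,y]$. *)

(* Defs.v *)
From HB Require Import structures.
From mathcomp Require Import all_boot all_order all_algebra.
From mathcomp Require Import all_classical.

Set Implicit Arguments.
Unset Strict Implicit.
Unset Printing Implicit Defensive.

Import GRing.Theory.
Local Open Scope classical_set_scope.
Local Open Scope ring_scope.

(* Z_2 is represented by bool: false is the even degree, true the odd one,
   i (+) j is the sum of degrees and (-1) ^+ (i && j) is (-1)^(ij).
   "x is homogeneous of degree i" is [degree i x]; 0 has both degrees. *)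
HB.mixin Record Lmodule_isLieSuperalgebra (R : comPzRingType) L
    of GRing.Lmodule R L := {
  degree : bool -> set L;
  bracket : L -> L -> L;
  degree0 : forall i, degree i 0;
  degreeP : forall i (a : R) x y,
    degree i x -> degree i y -> degree i (a *: x + y);
  degree_sum : forall x, exists x0 x1,
    [/\ degree false x0, degree true x1 & x = x0 + x1];
  degree_direct : forall x, degree false x -> degree true x -> x = 0;
  bracketPl : forall y (a : R) x x',
    bracket (a *: x + x') y = a *: bracket x y + bracket x' y;
  bracketPr : forall x (a : R) y y',
    bracket x (a *: y + y') = a *: bracket x y + bracket x y';
  degree_bracket : forall i j x y,
    degree i x -> degree j y -> degree (i (+) j) (bracket x y);
  bracket_anti : forall i j x y, degree i x -> degree j y ->
    bracket x y = - ((-1 : R) ^+ (i && j) *: bracket y x);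
  bracket_jacobi : forall i j k x y z,
    degree i x -> degree j y -> degree k z ->
    bracket x (bracket y z) =
      bracket (bracket x y) z + (-1 : R) ^+ (i && j) *: bracket y (bracket x z)
}.

#[short(type="lieSuperalgType")]
HB.structure Definition LieSuperalgebra (R : comPzRingType) :=
  { L of Lmodule_isLieSuperalgebra R L & GRing.Lmodule R L }.

Section LieSuperalgebraDefs.
Variables (R : comPzRingType) (L : lieSuperalgType R).
Implicit Types (D : L -> L) (d i j : bool).

Definition center : set L := [set x | forall y : L, bracket x y = 0].

(* [L, L], the R-submodule spanned by all brackets *)
Definition derived : set L :=
  [set z | exists (n : nat) (a : 'I_n -> R) (x y : 'I_n -> L),
     z = \sum_(k < n) a k *: bracket (x k) (y k)].

Definition perfect : Prop := derived = setT.

Definition homogeneous_end d D : Prop :=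
  linear D /\ (forall i x, degree i x -> degree (d (+) i) (D x)).

Definition hom_derivation d D : Prop :=
  homogeneous_end d D /\
  (forall i x y, degree i x ->
     D (bracket x y) =
       bracket (D x) y + (-1 : R) ^+ (d && i) *: bracket x (D y)).

Definition hom_triple_derivation d D : Prop :=
  homogeneous_end d D /\
  (forall i j x y z, degree i x -> degree j y ->
     D (bracket (bracket x y) z) =
       bracket (bracket (D x) y) z
       + (-1 : R) ^+ (d && i) *: bracket (bracket x (D y)) z
       + (-1 : R) ^+ (d && (i (+) j)) *: bracket (bracket x y) (D z)).

Definition Der : set (L -> L) :=
  [set D | exists D0 D1,
     [/\ hom_derivation false D0, hom_derivation true D1 & D = D0 + D1]].

Definition TDer : set (L -> L) :=
  [set D | exists D0 D1,
     [/\ hom_triple_derivation false D0, hom_triple_derivation true D1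
       & D = D0 + D1]].

Definition ad : set (L -> L) := [set (bracket x : L -> L) | x in [set: L]].

(* The components of degree i of an element and of an endomorphism; the set
   below is a singleton by degree_sum and degree_direct (see hpart_uniq). *)
Definition hpart i (x : L) : L :=
  xget 0 [set y | degree i y /\ degree (~~ i) (x - y)].

Definition end_hpart d D : L -> L :=
  fun x => \sum_(i : bool) hpart (d (+) i) (D (hpart i x)).

(* bilinear extension of D1 D2 - (-1)^(|D1||D2|) D2 D1 from homogeneous
   endomorphisms (see supercommutator_hom) *)
Definition supercommutator (D1 D2 : L -> L) : L -> L :=
  fun x => \sum_(i : bool) \sum_(j : bool)
    (end_hpart i D1 (end_hpart j D2 x)
     - (-1 : R) ^+ (i && j) *: end_hpart j D2 (end_hpart i D1 x)).

End LieSuperalgebraDefs.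

Arguments center {R} L.
Arguments derived {R} L.
Arguments perfect {R} L.
Arguments Der {R} L.
Arguments TDer {R} L.
Arguments ad {R} L.

Section DerLieSuperalgebra.
Variables (R : comPzRingType) (L : lieSuperalgType R).
Implicit Types (D f g h : L -> L) (d i j k : bool) (x y z : L) (a : R).

Lemma degreeD i x y : degree i x -> degree i y -> degree i (x + y).
Proof. by move=> hx hy; rewrite -[x]scale1r; exact: degreeP. Qed.

Lemma degreeZ i a x : degree i x -> degree i (a *: x).
Proof. by move=> hx; rewrite -[_ *: _]addr0; apply: degreeP => //; exact: degree0. Qed.

Lemma degreeB i x y : degree i x -> degree i y -> degree i (x - y).
Proof. by move=> hx hy; rewrite addrC -scaleN1r; exact: degreeP. Qed.

Lemma degree_direct' i x : degree i x -> degree (~~ i) x -> x = 0.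
Proof. by case: i => /= h1 h2; exact: degree_direct. Qed.

Lemma hpartP i x : degree i (hpart i x) /\ degree (~~ i) (x - hpart i x).
Proof.
rewrite /hpart; case: xgetP => [y _ []//|hN].
have [x0 [x1 [h0 h1 e]]] := degree_sum x; case: i hN => hN.
  by case: (hN x1); split => //=; rewrite e addrK.
by case: (hN x0); split => //=; rewrite e addrAC subrr add0r.
Qed.

Lemma hpart_uniq i x y : degree i y -> degree (~~ i) (x - y) -> hpart i x = y.
Proof.
move=> h1 h2; have [h3 h4] := hpartP i x; apply/eqP; rewrite -subr_eq0; apply/eqP.
apply: (@degree_direct' i); first exact: degreeB.
have -> : hpart i x - y = (x - y) - (x - hpart i x).
  by rewrite [RHS]addrC opprB addrA subrK.
exact: degreeB.
Qed.

Lemma hpart_id i x : degree i x -> hpart i x = x.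
Proof. by move=> h; apply: hpart_uniq => //; rewrite subrr; exact: degree0. Qed.

Lemma hpart_0 i x : degree (~~ i) x -> hpart i x = 0.
Proof. by move=> h; apply: hpart_uniq; rewrite ?subr0//; exact: degree0. Qed.

Lemma hpart_linear i : linear (hpart i : L -> L).
Proof.
move=> a x y; have [h1 h2] := hpartP i x; have [h3 h4] := hpartP i y.
apply: hpart_uniq; first exact: degreeP.
by rewrite opprD addrACA -scalerBr; exact: degreeP.
Qed.

Lemma hpart_sum x : hpart true x + hpart false x = x.
Proof.
have [x0 [x1 [h0 h1 ->]]] := degree_sum x.
have -> : hpart true (x0 + x1) = x1 by apply: hpart_uniq; rewrite ?addrK.
have -> : hpart false (x0 + x1) = x0.
  by apply: hpart_uniq => //; rewrite addrAC subrr add0r.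
exact: addrC.
Qed.

Lemma lin0 f : linear f -> f 0 = 0.
Proof. by move=> lf; have := lf (-1) 0 0; rewrite scaler0 addr0 scaleN1r addNr. Qed.
Lemma linD f x y : linear f -> f (x + y) = f x + f y.
Proof. by move=> lf; have := lf 1 x y; rewrite !scale1r. Qed.
Lemma linZ f a x : linear f -> f (a *: x) = a *: f x.
Proof. by move=> lf; have := lf a x 0; rewrite !addr0 (lin0 lf) addr0. Qed.
Lemma linB f x y : linear f -> f (x - y) = f x - f y.
Proof. by move=> lf; rewrite linD// -scaleN1r linZ// scaleN1r. Qed.

Lemma bracket_linl y : linear (bracket^~ y : L -> L).
Proof. by move=> a x x'; exact: bracketPl. Qed.
Lemma bracket_linr x : linear (bracket x : L -> L).
Proof. by move=> a y y'; exact: bracketPr. Qed.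

Lemma hom_derivation0 d : hom_derivation d (0 : L -> L).
Proof.
split; [split|] => [a x y|i x _|i x y _]; rewrite -?[(0 : L -> L) _]/(0 : L).
- by rewrite scaler0 addr0.
- exact: degree0.
- by rewrite (lin0 (bracket_linl y)) (lin0 (bracket_linr x)) scaler0 addr0.
Qed.

Lemma hom_derivationP d a f g :
  hom_derivation d f -> hom_derivation d g -> hom_derivation d (a *: f + g).
Proof.
move=> [[lf gf] df] [[lg gg] dg]; split; [split|] => [b x y|i x hx|i x y hx]; rewrite !fctE.
- rewrite lf lg !scalerDr !scalerA -!addrA [a * b]mulrC; congr (_ + _).
  by rewrite !addrA; congr (_ + _); rewrite addrC.
- by apply: degreeP; [exact: gf|exact: gg].
- rewrite (df _ _ _ hx) (dg _ _ _ hx) bracketPl bracketPr !scalerDr !scalerA.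
  by rewrite [a * _ ^+ _]mulrC addrACA.
Qed.

Lemma DerP a f g : Der L f -> Der L g -> Der L (a *: f + g).
Proof.
move=> [f0 [f1 [h0 h1 ->]]] [g0 [g1 [k0 k1 ->]]].
exists (a *: f0 + g0), (a *: f1 + g1); split; try exact: hom_derivationP.
by rewrite scalerDr addrACA.
Qed.

Lemma hom_derivation_Der d f : hom_derivation d f -> Der L f.
Proof.
move=> h; case: d h => h; [exists 0, f|exists f, 0];
  by split; rewrite ?add0r ?addr0//; exact: hom_derivation0.
Qed.

Lemma Der_linear f : Der L f -> linear f.
Proof.
move=> [f0 [f1 [[[l0 _] _] [[l1 _] _] ->]]] a x y; rewrite !fctE l0 l1.
by rewrite scalerDr addrACA.
Qed.

Lemma end_hpart_linear d f : linear f -> linear (end_hpart d f).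
Proof.
move=> lf a x y; rewrite /end_hpart scaler_sumr -big_split /=.
by apply: eq_bigr => i _; rewrite hpart_linear lf hpart_linear.
Qed.

Lemma end_hpartP d a f g : end_hpart d (a *: f + g) = a *: end_hpart d f + end_hpart d g.
Proof.
apply/funext => x; rewrite !fctE /end_hpart scaler_sumr -big_split /=.
by apply: eq_bigr => i _; rewrite hpart_linear.
Qed.

Lemma end_hpart_id d f : homogeneous_end d f -> end_hpart d f = f.
Proof.
move=> [lf gf]; apply/funext => x; rewrite /end_hpart big_bool /=.
have h i : hpart (d (+) i) (f (hpart i x)) = f (hpart i x).
  by apply: hpart_id; apply: gf; have [] := hpartP i x.
by rewrite !h -linD// hpart_sum.
Qed.

Lemma end_hpart_0 d f : homogeneous_end (~~ d) f -> end_hpart d f = 0.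
Proof.
move=> [lf gf]; apply/funext => x; rewrite /end_hpart big1//= => i _.
by apply: hpart_0; rewrite -addNb; apply: gf; have [] := hpartP i x.
Qed.

Lemma end_hpart_Der d f : Der L f -> hom_derivation d (end_hpart d f).
Proof.
move=> [f0 [f1 [h0 h1 ->]]]; rewrite -[f0]scale1r end_hpartP scale1r.
case: d; [rewrite (end_hpart_0 (d := true) h0.1) (end_hpart_id h1.1) add0r //|].
by rewrite (end_hpart_0 (d := false) h1.1) (end_hpart_id h0.1) addr0.
Qed.

Lemma supercommutator_hom i j f g : homogeneous_end i f -> homogeneous_end j g ->
  supercommutator f g = (f \o g) - (-1 : R) ^+ (i && j) *: (g \o f).
Proof.
move=> hf hg; apply/funext => x; rewrite /supercommutator !fctE.
have lg := hg.1; have lf := hf.1.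
rewrite (bigD1 i)//= [X in _ + X]big1 ?addr0; last first.
  move=> k ki; have -> : end_hpart k f = 0.
    by apply: end_hpart_0; have -> : ~~ k = i by case: k i ki {hf} => -[].
  have lj l := end_hpart_linear l lg.
  by rewrite big1// => l _; rewrite -[(0 : L -> L) _]/(0 : L) (lin0 (lj l)) scaler0 subr0.
rewrite (end_hpart_id hf) (bigD1 j)//= [X in _ + X]big1 ?addr0; last first.
  move=> k kj; have -> : end_hpart k g = 0.
    by apply: end_hpart_0; have -> : ~~ k = j by case: k j kj {hg} => -[].
  by rewrite -[(0 : L -> L) x]/(0 : L) (lin0 lf) scaler0 subr0.
by rewrite (end_hpart_id hg).
Qed.

Lemma supercommutatorPl a f f' g : linear g ->
  supercommutator (a *: f + f') g = a *: supercommutator f g + supercommutator f' g.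
Proof.
move=> lg; apply/funext => x; rewrite !fctE /supercommutator scaler_sumr -big_split /=.
apply: eq_bigr => i _; rewrite scaler_sumr -big_split /=; apply: eq_bigr => j _.
have lj := end_hpart_linear j lg.
rewrite end_hpartP !fctE lj scalerDr scalerBr !scalerA [a * _]mulrC.
by rewrite opprD addrACA.
Qed.

Lemma supercommutatorPr a f g g' : linear f ->
  supercommutator f (a *: g + g') = a *: supercommutator f g + supercommutator f g'.
Proof.
move=> lf; apply/funext => x; rewrite !fctE /supercommutator scaler_sumr -big_split /=.
apply: eq_bigr => i _; rewrite scaler_sumr -big_split /=; apply: eq_bigr => j _.
have li := end_hpart_linear i lf.
rewrite end_hpartP !fctE li scalerDr scalerBr !scalerA [a * _]mulrC.
by rewrite opprD addrACA.
Qed.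

Lemma hom_derivation_comm i j f g : hom_derivation i f -> hom_derivation j g ->
  hom_derivation (i (+) j) ((f \o g) - (-1 : R) ^+ (i && j) *: (g \o f)).
Proof.
move=> [[lf gf] df] [[lg gg] dg]; split; [split|] => [a x y|k x hx|k x y hx];
  rewrite !fctE.
- rewrite lg !lf lg scalerDr scalerBr !scalerA [a * _]mulrC.
  by rewrite opprD addrACA.
- apply: degreeB; first by rewrite -addbA; apply: gf; exact: gg.
  by apply: degreeZ; rewrite addbAC addbC; apply: gg; exact: gf.
rewrite (dg _ _ _ hx) (df _ _ _ hx) !(linD _ _ lf) !(linD _ _ lg).
rewrite (linZ _ _ lf) (linZ _ _ lg) (df _ _ _ hx) (dg _ _ _ hx).
rewrite (df _ _ _ (gg _ _ hx)) (dg _ _ _ (gf _ _ hx)).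
have -> : forall u v, bracket (u - (-1 : R) ^+ (i && j) *: v) y =
   bracket u y - (-1 : R) ^+ (i && j) *: bracket v y.
  by move=> u v; rewrite (linB _ _ (bracket_linl y)) (linZ _ _ (bracket_linl y)).
have -> : forall u v, bracket x (u - (-1 : R) ^+ (i && j) *: v) =
   bracket x u - (-1 : R) ^+ (i && j) *: bracket x v.
  by move=> u v; rewrite (linB _ _ (bracket_linr x)) (linZ _ _ (bracket_linr x)).
have e (A B C E P Q U V : L) : B = Q -> C = P ->
  (A + B) + (C + E) - ((U + P) + (Q + V)) = (A - U) + (E - V).
  move=> -> ->; rewrite !opprD !addrA.
  by rewrite [LHS](ACl (1*5*4*8*3*6*2*7)) /= !addrK.
rewrite scalerBr !scalerDr !scalerA -!signr_addb e; last 2 first.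
- by congr ((-1) ^+ nat_of_bool _ *: _); case: (i) (j) (k) => -[] [].
- by congr ((-1) ^+ nat_of_bool _ *: _); case: (i) (j) (k) => -[] [].
congr (_ + _); congr (_ *: _ - _ *: _);
  by congr ((-1) ^+ nat_of_bool _); case: (i) (j) (k) => -[] [].
Qed.

Lemma supercommutator_anti i j f g :
  homogeneous_end i f -> homogeneous_end j g ->
  supercommutator f g = - ((-1 : R) ^+ (i && j) *: supercommutator g f).
Proof.
move=> hf hg; rewrite (supercommutator_hom hf hg) (supercommutator_hom hg hf).
by rewrite scalerBr scalerA -signr_addb andbC addbb scale1r opprB.
Qed.

Lemma supercommutator_jacobi i j k f g h :
  hom_derivation i f -> hom_derivation j g -> hom_derivation k h ->
  supercommutator f (supercommutator g h) =
    supercommutator (supercommutator f g) h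
    + (-1 : R) ^+ (i && j) *: supercommutator g (supercommutator f h).
Proof.
move=> hf hg hh.
rewrite (supercommutator_hom hg.1 hh.1) (supercommutator_hom hf.1 hg.1).
rewrite (supercommutator_hom hf.1 hh.1).
rewrite (supercommutator_hom hf.1 (hom_derivation_comm hg hh).1).
rewrite (supercommutator_hom (hom_derivation_comm hf hg).1 hh.1).
rewrite (supercommutator_hom hg.1 (hom_derivation_comm hf hh).1).
have lf := hf.1.1; have lg := hg.1.1; have lh := hh.1.1.
apply/funext => x; rewrite !fctE !(linB _ _ lf) !(linB _ _ lg) !(linB _ _ lh).
rewrite !(linZ _ _ lf) !(linZ _ _ lg) !(linZ _ _ lh).
rewrite !scalerBr !scalerA -!signr_addb.
have e (A B C E P P' Q Q' U V W X : L) : A = U -> B = W -> C = X -> E = V ->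
   P = P' -> Q = Q' ->
   (A - B) - (C - E) = ((U - P) - (Q - V)) + ((P' - X) - (W - Q')).
  move=> -> -> -> -> -> ->; rewrite !opprB !addrA.
  by rewrite [RHS](ACl (1*8*3*6*5*2*7*4)) /= !addrK.
by apply: e => //; congr ((-1) ^+ nat_of_bool _ *: _); case: (i) (j) (k) => -[] [].
Qed.

Lemma supercommutator_Der f g : Der L f -> Der L g -> Der L (supercommutator f g).
Proof.
move=> hf hg; have [f0 [f1 [f0h f1h ef]]] := hf; have [g0 [g1 [g0h g1h eg]]] := hg.
have lg0 := g0h.1.1; have lg1 := g1h.1.1; have lf0 := f0h.1.1; have lf1 := f1h.1.1.
have lg := Der_linear hg.
have key i j u v : hom_derivation i u -> hom_derivation j v ->
    Der L (supercommutator u v).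
  move=> hu hv; rewrite (supercommutator_hom hu.1 hv.1).
  exact: hom_derivation_Der (hom_derivation_comm hu hv).
rewrite ef -[f0]scale1r supercommutatorPl// eg.
rewrite -[g0]scale1r !supercommutatorPr//.
by apply: (DerP _ (DerP _ _ _) (DerP _ _ _)); apply: key; eassumption.
Qed.

Definition Der_pred : {pred L -> L} := [pred D | `[< Der L D >]].

Lemma Der_submod_closed : submod_closed Der_pred.
Proof.
split; first by apply/asboolP; exact: hom_derivation_Der (hom_derivation0 false).
by move=> a f g /asboolP hf /asboolP hg; apply/asboolP; exact: DerP.
Qed.

HB.instance Definition _ :=
  GRing.isSubmodClosed.Build R (L -> L) Der_pred Der_submod_closed.

Record derType := MkDer { der_fun :> L -> L; _ : der_fun \in Der_pred }.

HB.instance Definition _ := [isSub for der_fun].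
HB.instance Definition _ := [Choice of derType by <:].
HB.instance Definition _ := [SubChoice_isSubLmodule of derType by <:].

Lemma derTypeP (D : derType) : Der L D.
Proof. by case: D => D /= /asboolP. Qed.

Definition der_degree d : set derType := [set D | hom_derivation d D].

Definition der_bracket (D1 D2 : derType) : derType :=
  MkDer (introT (asboolP _) (supercommutator_Der (derTypeP D1) (derTypeP D2))).

Lemma der_bracketE i j (D1 D2 : derType) : der_degree i D1 -> der_degree j D2 ->
  der_bracket D1 D2 = (D1 \o D2) - (-1 : R) ^+ (i && j) *: (D2 \o D1) :> (L -> L).
Proof. by move=> h1 h2; exact: supercommutator_hom h1.1 h2.1. Qed.

Fact der_degree0 d : der_degree d 0.
Proof. exact: hom_derivation0. Qed.

Fact der_degreeP d a (D1 D2 : derType) :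
  der_degree d D1 -> der_degree d D2 -> der_degree d (a *: D1 + D2).
Proof. exact: hom_derivationP. Qed.

Fact der_degree_sum (D : derType) : exists D0 D1 : derType,
  [/\ der_degree false D0, der_degree true D1 & D = D0 + D1].
Proof.
have [f0 [f1 [h0 h1 e]]] := derTypeP D.
exists (MkDer (introT (asboolP _) (hom_derivation_Der h0))).
exists (MkDer (introT (asboolP _) (hom_derivation_Der h1))).
by split=> //; exact: val_inj.
Qed.

Fact der_degree_direct (D : derType) :
  der_degree false D -> der_degree true D -> D = 0.
Proof.
move=> h0 h1; apply: val_inj => /=.
by rewrite -(end_hpart_id h0.1) (end_hpart_0 (d := false) h1.1).
Qed.

Fact der_bracketPl (D : derType) a (D1 D2 : derType) :
  der_bracket (a *: D1 + D2) D = a *: der_bracket D1 D + der_bracket D2 D.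
Proof.
by apply: val_inj; exact: (supercommutatorPl a _ _ (Der_linear (derTypeP D))).
Qed.

Fact der_bracketPr (D : derType) a (D1 D2 : derType) :
  der_bracket D (a *: D1 + D2) = a *: der_bracket D D1 + der_bracket D D2.
Proof.
by apply: val_inj; exact: (supercommutatorPr a _ _ (Der_linear (derTypeP D))).
Qed.

Fact der_degree_bracket i j (D1 D2 : derType) :
  der_degree i D1 -> der_degree j D2 -> der_degree (i (+) j) (der_bracket D1 D2).
Proof.
move=> h1 h2; rewrite /der_degree /= (supercommutator_hom h1.1 h2.1).
exact: hom_derivation_comm.
Qed.

Fact der_bracket_anti i j (D1 D2 : derType) :
  der_degree i D1 -> der_degree j D2 ->
  der_bracket D1 D2 = - ((-1 : R) ^+ (i && j) *: der_bracket D2 D1).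
Proof.
by move=> h1 h2; apply: val_inj; exact: supercommutator_anti h1.1 h2.1.
Qed.

Fact der_bracket_jacobi i j k (D1 D2 D3 : derType) :
  der_degree i D1 -> der_degree j D2 -> der_degree k D3 ->
  der_bracket D1 (der_bracket D2 D3) =
    der_bracket (der_bracket D1 D2) D3
    + (-1 : R) ^+ (i && j) *: der_bracket D2 (der_bracket D1 D3).
Proof.
by move=> h1 h2 h3; apply: val_inj; exact: supercommutator_jacobi h1 h2 h3.
Qed.

HB.instance Definition _ := Lmodule_isLieSuperalgebra.Build R derType
  der_degree0 der_degreeP der_degree_sum der_degree_direct
  der_bracketPl der_bracketPr der_degree_bracket der_bracket_anti
  der_bracket_jacobi.

End DerLieSuperalgebra.

Arguments derType {R} L.

(* Main.v *)
Require Import Defs.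
From HB Require Import structures.
From mathcomp Require Import all_boot all_order all_algebra.
From mathcomp Require Import all_classical.

Import GRing.Theory.
Local Open Scope classical_set_scope.
Local Open Scope ring_scope.

(** The idea, for a homogeneous triple derivation D of a perfect, centerless L,
    is to measure how far D is from being a derivation.  The obstruction
      F(x, y) = [D x, y] + (-1)^(|D||x|) [x, D y] - D [x, y]
    turns out to be F(x, y) = [e_x, y] for some e_x, unique as the center is
    zero: when x = [u, v] the triple derivation rule says exactly this, with
    e_x = - F(u, v), and brackets span L since L is perfect ([defect_exists]).
    Two more properties of e follow:
    - e_[x, y] = - [e_x, y] ([defect_bracket]);
    - [e_x, y] = (-1)^(|D||x|) [x, e_y], because F inherits the graded
      antisymmetry of the bracket ([defect_sym]).
    Computing e on both sides of the Jacobi identity for [x, [y, z]], the left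
    side involves one bracket with e, hence one minus sign, whereas the terms on
    the right pass through two brackets each, hence two minus signs that cancel;
    the outcome is - [e_x, [y, z]] = [e_x, [y, z]].  As 2 is invertible and
    L = [L, L], e_x is central, hence zero, so F = 0 and D is a derivation
    ([defect_eq0], [derivation_of_triple]).

    For a triple derivation D of Der(L), which need not be perfect, the
    relation [f, ad x] = ad (f x) makes ad(L) an ideal of Der(L)
    ([bracket_inner], [bracket_inner_range]).  Since L = [[L, L], L], D maps
    ad(L) to itself ([triple_inner_range]); the center being zero, ad is
    injective, so D (ad x) = ad (delta x) for a unique triple derivation delta
    of L, which is a derivation by the first part.  The difference
    D - [delta, -] is a triple derivation killing ad(L), and such a map is zero
    ([triple_inner_eq0]). *)

(** * Bracket calculus and induction over a perfect Lie superalgebra *)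

Section Generalities.
Local Set Implicit Arguments.
Local Unset Strict Implicit.
Variables (R : comPzRingType) (L : lieSuperalgType R).
Implicit Types (x y z e : L) (D f : L -> L) (i j k d : bool).

Lemma linN f x : linear f -> f (- x) = - f x.
Proof. by move=> lf; rewrite -scaleN1r linZ// scaleN1r. Qed.

Lemma bracketNl x y : bracket (- x) y = - bracket x y.
Proof. exact: linN (bracket_linl y). Qed.

Lemma bracketNr x y : bracket x (- y) = - bracket x y.
Proof. exact: linN (bracket_linr x). Qed.

Lemma bracketDl x x' y : bracket (x + x') y = bracket x y + bracket x' y.
Proof. exact: linD (bracket_linl y). Qed.

Lemma bracketDr x y y' : bracket x (y + y') = bracket x y + bracket x y'.
Proof. exact: linD (bracket_linr x). Qed.

Lemma bracketZl a x y : bracket (a *: x) y = a *: bracket x y.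
Proof. exact: linZ (bracket_linl y). Qed.

Lemma bracketZr a x y : bracket x (a *: y) = a *: bracket x y.
Proof. exact: linZ (bracket_linr x). Qed.

Lemma bracket0l y : bracket 0 y = 0 :> L.
Proof. exact: lin0 (bracket_linl y). Qed.

Lemma bracket0r y : bracket y 0 = 0 :> L.
Proof. exact: lin0 (bracket_linr y). Qed.

Definition bracketE := (bracketDl, bracketDr, bracketNl, bracketNr,
  bracketZl, bracketZr, bracket0l, bracket0r).

Lemma signZK i x : (-1 : R) ^+ i *: ((-1 : R) ^+ i *: x) = x.
Proof. by rewrite scalerA -signr_addb addbb scale1r. Qed.

Lemma hpart_degree i x : degree i (hpart i x).
Proof. by have [] := hpartP i x. Qed.

(** Reduces a statement about all elements to homogeneous ones, where the sign
    rules are available. *)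
Lemma homogeneous_ind (P : L -> Prop) :
    (forall x y, P x -> P y -> P (x + y)) ->
    (forall i x, degree i x -> P x) -> forall x, P x.
Proof.
move=> PD Ph x; rewrite -(hpart_sum x).
by apply: PD; exact: Ph (hpart_degree _ _).
Qed.

(** How perfectness is used: it replaces the decomposition of a homogeneous
    element as a sum of brackets of homogeneous elements.  The property may
    depend on the degree, as signs do; the proof follows the degree by
    showing [P i] of the component of degree i of every element. *)
Lemma graded_perfect_ind (P : bool -> L -> Prop) : perfect L ->
    (forall i a x y, P i x -> P i y -> P i (a *: x + y)) ->
    (forall i j x y, degree i x -> degree j y -> P (i (+) j) (bracket x y)) ->
  forall i x, degree i x -> P i x.
Proof.
move=> Lp PP Pb i x hx; rewrite -(hpart_id hx) => {hx}.
(* 0 is homogeneous of both degrees, so that [0, 0] has any given degree. *)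
have P0 k : P k 0.
  by rewrite -[k]addbF -(bracket0l 0); apply: Pb; exact: degree0.
have Q0 : P i (hpart i (0 : L)) by rewrite hpart_id//; exact: degree0.
have QP a u v : P i (hpart i u) -> P i (hpart i v) ->
    P i (hpart i (a *: u + v)) by rewrite hpart_linear; exact: PP.
have QD u v : P i (hpart i u) -> P i (hpart i v) ->
    P i (hpart i (u + v)) by rewrite -{2}[u]scale1r; exact: QP.
have : derived L x by rewrite Lp.
move=> [n [a [u [v ->]]]]; elim/big_ind : _ => // k _.
rewrite -[_ *: _]addr0; apply: QP => //.
elim/homogeneous_ind : (u k) => [w w' hw hw'|l w hw].
  by rewrite bracketDl; exact: QD.
elim/homogeneous_ind : (v k) => [t t' ht ht'|m t ht].
  by rewrite bracketDr; exact: QD.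
have hb := degree_bracket _ _ _ _ hw ht.
have [<-|ne] := eqVneq (l (+) m) i; first by rewrite hpart_id//; exact: Pb.
rewrite hpart_0//; have -> // : ~~ i = l (+) m.
by move: ne; case: (i) (l (+) m) => -[].
Qed.

Lemma perfect_ind (P : L -> Prop) : perfect L ->
    (forall a x y, P x -> P y -> P (a *: x + y)) ->
    (forall i j x y, degree i x -> degree j y -> P (bracket x y)) ->
  forall x, P x.
Proof.
move=> Lp PP Pb; apply: homogeneous_ind => [x y|i x].
  by rewrite -{2}[x]scale1r; exact: PP.
exact: (@graded_perfect_ind (fun=> P)).
Qed.

(** L = [[L, L], L]. *)
Lemma perfect_ind3 (P : L -> Prop) : perfect L ->
    (forall a x y, P x -> P y -> P (a *: x + y)) ->
    (forall i j k x y z, degree i x -> degree j y -> degree k z ->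
       P (bracket (bracket x y) z)) ->
  forall x, P x.
Proof.
move=> Lp PP Pb; apply: perfect_ind => // i k w z _ hz.
move: w; apply: perfect_ind => // [a x y Px Py|{}i j x y hx hy].
  by rewrite bracketPl; exact: PP.
exact: Pb hx hy hz.
Qed.

Lemma center_eq0 x : center L = [set 0] ->
  (forall y, bracket x y = 0) -> x = 0.
Proof. by move=> cL hx; have : center L x by []; rewrite cL. Qed.

Lemma bracket_inj x y : center L = [set 0] ->
  (forall z, bracket x z = bracket y z) -> x = y.
Proof.
move=> cL h; apply/eqP; rewrite -subr_eq0; apply/eqP; apply: center_eq0 => // z.
by rewrite !bracketE h subrr.
Qed.

(** Without center, the degree of x can be read off the map [x, -]: the
    component of x of the other degree has brackets of both degrees, hence
    zero brackets. *)
Lemma degree_bracketK i x : center L = [set 0] ->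
  (forall j y, degree j y -> degree (i (+) j) (bracket x y)) -> degree i x.
Proof.
move=> cL hx; have [hi hn] := hpartP i x.
suff /eqP : x - hpart i x = 0 by rewrite subr_eq0 => /eqP ->.
apply: center_eq0 => //; apply: homogeneous_ind => [y z|j y hy].
  by rewrite bracketDr => -> ->; rewrite addr0.
apply: (@degree_direct' _ _ (i (+) j)).
  rewrite bracketDl bracketNl; apply: degreeB; first exact: hx.
  exact: degree_bracket.
by rewrite -addNb; exact: degree_bracket.
Qed.

Lemma homogeneous_bracket i x : degree i x -> homogeneous_end i (bracket x).
Proof.
by move=> hx; split=> [|j y hy]; [exact: bracket_linr|exact: degree_bracket].
Qed.

Lemma hom_derivation_bracket i x : degree i x -> hom_derivation i (bracket x).
Proof.
move=> hx; split=> [|j y z hy]; first exact: homogeneous_bracket.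
elim/homogeneous_ind : z => [z z' hz hz'|k z hz]; last exact: bracket_jacobi hz.
by rewrite !bracketE hz hz' scalerDr addrACA.
Qed.

Lemma ad_Der : ad L `<=` Der L.
Proof.
move=> _ [x _ <-]; exists (bracket (hpart false x)), (bracket (hpart true x)).
split; try exact: hom_derivation_bracket (hpart_degree _ _).
by apply/funext => y; rewrite !fctE -bracketDl addrC hpart_sum.
Qed.

Lemma hom_derivation_triple d D : hom_derivation d D -> hom_triple_derivation d D.
Proof.
move=> [hD dD]; split=> // i j x y z hx hy.
rewrite (dD _ _ z (degree_bracket _ _ _ _ hx hy)) (dD _ _ y hx).
by rewrite !bracketE.
Qed.

Lemma Der_TDer : Der L `<=` TDer L.
Proof.
by move=> _ [D0 [D1 [h0 h1 ->]]]; exists D0, D1; split=> //;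
  exact: hom_derivation_triple.
Qed.

Lemma hom_triple_derivationB d D D' : hom_triple_derivation d D ->
  hom_triple_derivation d D' -> hom_triple_derivation d (D - D').
Proof.
move=> [[lD gD] tD] [[lD' gD'] tD']; split; first split.
- by move=> a x y; rewrite !fctE lD lD' scalerBr opprD addrACA.
- by move=> i x hx; rewrite !fctE; apply: degreeB; [exact: gD|exact: gD'].
move=> i j x y z hx hy; rewrite !fctE (tD _ _ _ _ _ hx hy) (tD' _ _ _ _ _ hx hy).
by rewrite !bracketE !scalerBr !opprD !addrA [RHS](ACl (1*3*5*2*4*6)).
Qed.

End Generalities.

(** * Triple derivations of a perfect centerless Lie superalgebra *)

Section TripleDerivation.
Local Set Implicit Arguments.
Local Unset Strict Implicit.
Variables (R : comPzRingType) (L : lieSuperalgType R) (d : bool) (D : L -> L).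
Implicit Types (x y z e f : L) (i j k : bool).

(** [defect i x e] says that bracketing with e is the obstruction
    F(x, -) to the derivation rule at x; it determines e modulo the center. *)
Definition defect i x e : Prop := degree (d (+) i) e /\
  forall y, bracket e y =
    bracket (D x) y + (-1 : R) ^+ (d && i) *: bracket x (D y) - D (bracket x y).

Hypothesis tD : hom_triple_derivation d D.

Lemma defectP i a x y e f : defect i x e -> defect i y f ->
  defect i (a *: x + y) (a *: e + f).
Proof.
have [[lD _] _] := tD.
move=> [he xe] [hf yf]; split=> [|z]; first exact: degreeP.
rewrite bracketPl xe yf lD !bracketPl lD scalerBr !scalerDr !scalerA.
by rewrite [a * _]mulrC opprD !addrA [LHS](ACl (1*4*2*5*3*6)).
Qed.

(** The triple derivation rule for [[x, y], z], read as a statement about the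
    pair ([x, y], z). *)
Lemma defect_bracket0 i j x y : degree i x -> degree j y ->
  defect (i (+) j) (bracket x y)
    (D (bracket x y) - bracket (D x) y - (-1 : R) ^+ (d && i) *: bracket x (D y)).
Proof.
have [[lD gD] D3] := tD => hx hy; split=> [|z].
  apply: degreeB; [apply: degreeB|apply: degreeZ].
  - exact: gD (degree_bracket _ _ _ _ hx hy).
  - by rewrite addbA; apply: degree_bracket => //; exact: gD.
  - by rewrite addbCA; apply: degree_bracket => //; exact: gD.
rewrite (D3 _ _ _ _ _ hx hy) !bracketE.
by rewrite !opprD !addrA [RHS](ACl (1*3*4*(2*5))) /= subrr addr0.
Qed.

Lemma defect_bracket i j x y e : degree i x -> degree j y ->
  defect i x e -> defect (i (+) j) (bracket x y) (- bracket e y).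
Proof.
move=> hx hy [_ xe]; rewrite xe.
suff <- : D (bracket x y) - bracket (D x) y - (-1) ^+ (d && i) *: bracket x (D y)
  = - (bracket (D x) y + (-1) ^+ (d && i) *: bracket x (D y) - D (bracket x y)).
  exact: defect_bracket0.
by rewrite opprB opprD addrA.
Qed.

(** The obstruction F is graded antisymmetric, like the bracket. *)
Lemma defect_sym i j x y e f : degree i x -> degree j y ->
  defect i x e -> defect j y f ->
  bracket e y = (-1 : R) ^+ (d && i) *: bracket x f.
Proof.
have [[lD gD] _] := tD => hx hy [_ xe] [hf yf].
rewrite xe (addrC (bracket (D x) y)) (bracket_anti _ _ _ _ hx hf) yf.
rewrite (bracket_anti _ _ _ _ (gD _ _ hx) hy) (bracket_anti _ _ _ _ hx (gD _ _ hy)).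
rewrite (bracket_anti _ _ _ _ hx hy) (linN _ lD) (linZ _ _ lD).
(* Once d, i, j are known all signs are explicit. *)
case: (d) (i) (j) => -[] [] /=;
  rewrite ?expr0 ?expr1 ?scaleN1r ?scale1r ?opprD ?opprK //.
Qed.

Lemma defect_exists i x : perfect L -> degree i x -> exists e, defect i x e.
Proof.
move=> Lp; move: i x; apply: graded_perfect_ind => //.
  move=> i a x y [e he] [f hf].
  by exists (a *: e + f); exact: defectP.
by move=> i j x y hx hy; eexists; exact: defect_bracket0 hx hy.
Qed.

Lemma defect_bracket_uniq i x e f z :
  defect i x e -> defect i x f -> bracket e z = bracket f z.
Proof. by move=> [_ he] [_ hf]; rewrite he hf. Qed.

(** Both sides of the Jacobi identity for [x, [y, z]] give a defect of
    [x, [y, z]]: the left side gives - [e, [y, z]] and the right side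
    [e, [y, z]], so that 2 [e, [y, z]] = 0. *)
Lemma defect_eq0 i x e : (exists h : R, 2%:R * h = 1) -> perfect L ->
  center L = [set 0] -> degree i x -> defect i x e -> e = 0.
Proof.
move=> [h h2] Lp cL hx xe; apply: center_eq0 => //.
apply: perfect_ind => // [a w w'|j k y z hy hz].
  by rewrite bracketPr => -> ->; rewrite scaler0 addr0.
have [g yg] := defect_exists Lp hy.
have hyz := degree_bracket _ _ _ _ hy hz.
have hxz := degree_bracket _ _ _ _ hx hz.
have hxy := degree_bracket _ _ _ _ hx hy.
have he := xe.1.
have d1 := defect_bracket hx hyz xe.
have d2 := defect_bracket hxy hz (defect_bracket hx hy xe).
have d3 := defect_bracket hy hxz yg.
rewrite (defect_sym hy hxz yg (defect_bracket hx hz xe)) in d3.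
(* d3 reads (-1)^(|D||y|) [y, [e, z]] after the symmetry is applied, so that
   d2 and d3 add up to the Jacobi identity for [e, [y, z]]. *)
have d23 : defect (i (+) (j (+) k)) (bracket x (bracket y z)) (bracket e (bracket y z)).
  rewrite (bracket_jacobi _ _ _ _ _ _ hx hy hz) (bracket_jacobi _ _ _ _ _ _ he hy hz).
  rewrite addrC [X in defect _ _ X]addrC; rewrite addbCA in d3.
  rewrite -addbA in d2; have := defectP ((-1) ^+ (i && j)) d3 d2.
  rewrite !bracketE !scalerN !opprK scalerA -signr_addb.
  by rewrite (_ : (d (+) i) && j = (i && j) (+) (d && j)) // andb_addl addbC.
have X2 : bracket e (bracket y z) = - bracket e (bracket y z).
  by apply: bracket_inj => // t; exact: defect_bracket_uniq d23 d1.
rewrite -[LHS]scale1r -h2 mulrC -scalerA scaler_nat mulr2n.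
by rewrite {1}X2 addNr scaler0.
Qed.

Lemma derivation_of_triple : (exists h : R, 2%:R * h = 1) -> perfect L ->
  center L = [set 0] -> hom_derivation d D.
Proof.
move=> h2 Lp cL; split=> [|i x y hx]; first exact: tD.1.
have [e xe] := defect_exists Lp hx; have := xe.2 y.
rewrite (defect_eq0 h2 Lp cL hx xe) bracket0l => /esym/eqP.
by rewrite subr_eq0 => /eqP.
Qed.

End TripleDerivation.

(** * The ideal of inner derivations *)

Section InnerDerivations.
Local Set Implicit Arguments.
Local Unset Strict Implicit.
Variables (R : comPzRingType) (L : lieSuperalgType R).
Implicit Types (x y : L) (f g : derType L) (i j : bool).

Definition inner x : derType L :=
  MkDer (introT (asboolP _) (@ad_Der R L _ (ex_intro2 _ _ x I erefl))).

Lemma innerE x y : inner x y = bracket x y. Proof. by []. Qed.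

Lemma inner_linear : linear inner.
Proof. by move=> a x y; apply/val_inj/funext => z; exact: bracketPl. Qed.

HB.instance Definition _ :=
  GRing.isLinear.Build R L (derType L) *:%R inner inner_linear.

Lemma innerD x y : inner (x + y) = inner x + inner y.
Proof. exact: linearD. Qed.

Lemma innerZ a x : inner (a *: x) = a *: inner x.
Proof. exact: linearZ. Qed.

Lemma innerN x : inner (- x) = - inner x.
Proof. exact: linearN. Qed.

Lemma degree_inner i x : degree i x -> degree i (inner x).
Proof. exact: hom_derivation_bracket. Qed.

Lemma bracket_inner f x : bracket f (inner x) = inner (f x).
Proof.
elim/homogeneous_ind : f => [f g hf hg|i f hf].
  by rewrite bracketDl hf hg -innerD.
elim/homogeneous_ind : x => [x y hx hy|j x hx].
  by rewrite innerD bracketDr hx hy -innerD (linD _ _ hf.1.1).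
apply: val_inj; apply: etrans (der_bracketE hf (degree_inner hx)) _.
apply/funext => y; rewrite !fctE !innerE.
by rewrite (hf.2 _ _ _ hx) addrK.
Qed.

(** In this form [inner] is a morphism of Lie superalgebras, which transports
    triple derivation identities between L and ad(L). *)
Lemma inner_bracket x y : inner (bracket x y) = bracket (inner x) (inner y).
Proof. by rewrite bracket_inner. Qed.

(** Stated with the inner derivation on the left, where the sign of the
    antisymmetry depends on homogeneous components; only membership in the
    ideal matters below. *)
Lemma bracket_inner_range f x : exists y, bracket (inner x) f = inner y.
Proof.
elim/homogeneous_ind : f => [f g [y hf] [z hg]|i f hf].
  by exists (y + z); rewrite bracketDr hf hg innerD.
elim/homogeneous_ind : x => [x y [z hx] [t hy]|j x hx].
  by exists (z + t); rewrite innerD bracketDl hx hy innerD.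
exists (- ((-1) ^+ (j && i) *: f x)).
rewrite (bracket_anti _ _ _ _ (degree_inner hx) hf) bracket_inner.
by rewrite innerN innerZ.
Qed.

Hypothesis cL : center L = [set 0].

Lemma inner_inj : injective inner.
Proof.
move=> x y e; apply: bracket_inj => // z.
by rewrite -!innerE e.
Qed.

Lemma degree_innerK i x : degree i (inner x) -> degree i x.
Proof. by move=> [[_ gx] _]; apply: degree_bracketK => // j y; exact: gx. Qed.

End InnerDerivations.

(** * Triple derivations of the derivation superalgebra *)

Section TripleDerivationOfDer.
Local Set Implicit Arguments.
Local Unset Strict Implicit.
Variables (R : comPzRingType) (L : lieSuperalgType R).
Hypotheses (Lp : perfect L) (cL : center L = [set 0]).
Implicit Types (x y z : L) (d i j k : bool) (D : derType L -> derType L).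

(** On [[ad x, ad y], ad z] each of the three terms of the rule is a bracket
    having at least one inner factor, so it stays in the ideal ad(L). *)
Lemma triple_inner_range d D : hom_triple_derivation d D ->
  forall x, exists y, D (inner x) = inner y.
Proof.
move=> [[lD gD] D3].
apply: perfect_ind3 => // [a x y [x' hx] [y' hy]|i j k x y z hx hy hz].
  by exists (a *: x' + y'); rewrite linearP lD hx hy linearP.
rewrite !inner_bracket (D3 _ _ _ _ _ (degree_inner hx) (degree_inner hy)).
have [x' ->] := bracket_inner_range (D (inner y)) x.
rewrite -(inner_bracket x y).
have [y' ->] := bracket_inner_range (D (inner z)) (bracket x y).
rewrite bracket_inner -!inner_bracket.
by eexists; rewrite -!innerZ -!innerD.
Qed.

(** For x, y in L and f in Der(L), [[ad x, ad y], f] lies in ad(L), where D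
    vanishes, so the triple derivation rule leaves [[ad x, ad y], D f] = 0;
    this says ad ((D f) [x, y]) = 0, and brackets span L. *)
Lemma triple_inner_eq0 d D : hom_triple_derivation d D ->
  (forall x, D (inner x) = 0) -> D = 0.
Proof.
move=> [[lD gD] D3] D0; apply/funext; apply: homogeneous_ind => [f g|k f hf].
  by rewrite (linD _ _ lD) => -> ->; exact: addr0.
suff Df0 x : D f x = 0 by apply/val_inj/funext.
move: x; apply: perfect_ind => // [a x y|i j x y hx hy].
  by rewrite (Der_linear (derTypeP (D f))) => -> ->; rewrite scaler0 addr0.
have hxy := degree_bracket _ _ _ _ hx hy.
apply: (inner_inj cL); rewrite -bracket_inner.
have [t xyf] := bracket_inner_range f (bracket x y).
have := D3 _ _ _ _ f (degree_inner hx) (degree_inner hy).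
rewrite -inner_bracket xyf !D0 !bracketE scaler0 !add0r => /esym e.
rewrite (bracket_anti _ _ _ _ (gD _ _ hf) (degree_inner hxy)).
move/(congr1 (fun u => (-1) ^+ (d && (i (+) j)) *: u)): e.
by rewrite signZK scaler0 => ->; rewrite scaler0 oppr0 linear0.
Qed.

Lemma triple_of_Der_eq_bracket d D : (exists h : R, 2%:R * h = 1) ->
  hom_triple_derivation d D ->
  exists2 delta : derType L, degree d delta & D = bracket delta.
Proof.
move=> h2 tD; have [[lD gD] D3] := tD.
have [delta dE] := choice (triple_inner_range tD).
have dD : hom_triple_derivation d delta.
  split; first split=> [a x y|i x hx].
  - by apply: (inner_inj cL); rewrite -dE linearP lD !dE linearP.
  - by apply: (degree_innerK cL); rewrite -dE; apply: gD; exact: degree_inner.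
  move=> i j x y z hx hy; apply: (inner_inj cL).
  rewrite !innerD !innerZ !inner_bracket -!dE.
  by rewrite !inner_bracket (D3 _ _ _ _ _ (degree_inner hx) (degree_inner hy)).
have {}dD := derivation_of_triple dD h2 Lp cL.
pose D' := MkDer (introT (asboolP _) (hom_derivation_Der dD)).
exists D' => //.
have tD' := hom_triple_derivationB tD
  (hom_derivation_triple (hom_derivation_bracket (dD : degree d D'))).
apply/eqP; rewrite -subr_eq0; apply/eqP.
apply: (triple_inner_eq0 tD') => x.
by rewrite !fctE bracket_inner dE subrr.
Qed.

End TripleDerivationOfDer.

Theorem theorem1p1 (R : comPzRingType) (half : exists h : R, 2%:R * h = 1)
    (L : lieSuperalgType R) (L_perfect : perfect L)
    (L_centerless : center L = [set 0]) :
  TDer L = Der L /\ TDer (derType L) = ad (derType L).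
Proof.
split; apply/seteqP; split.
- move=> _ [D0 [D1 [h0 h1 ->]]].
  by exists D0, D1; split=> //; exact: derivation_of_triple.
- exact: Der_TDer.
- move=> _ [D0 [D1 [h0 h1 ->]]].
  have [f _ ->] := triple_of_Der_eq_bracket L_perfect L_centerless half h0.
  have [g _ ->] := triple_of_Der_eq_bracket L_perfect L_centerless half h1.
  by exists (f + g) => //; apply/funext => h; rewrite bracketDl.
- by move=> D /ad_Der/Der_TDer.
Qed.
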